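(* Let $G=\mathcal{G}(\Gamma,\{G_v\}_{v\in\Gamma})$ and $G'=\mathcal{G}(\Gamma',\{H_w\}_{w\in\Gamma'})$ be graph products over finite graphs $\Gamma,\Gamma'$, where all $G_v$ and $H_w$ are finite groups. Then $$G\equiv G'\iff G\simeq G'.$$ In particular, two right-angled Coxeter groups are elementarily equivalent if and only if they are isomorphic.
   Context: Graphs are finite and simplicial. The graph product $\mathcal{G}(\Gamma,\{G_v\})$ is the quotient of the free product of the groups $G_v$, $v\in V(\Gamma)$, by the relations saying that $G_u$ and $G_v$ commute elementwise whenever $(u,v)\in E(\Gamma)$. A right-angled Coxeter group is a graph product (over a finite graph) in which all vertex groups have order $2$. $\equiv$ denotes elementary equivalence in the language of groups and $\simeq$ isomorphism. *)

(* Defs.v *)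
From HB Require Import structures.
From mathcomp Require Import all_boot fingroup.
From mathcomp Require Import generic_quotient boolp.

Set Implicit Arguments.
Unset Strict Implicit.
Unset Printing Implicit Defensive.

Local Open Scope group_scope.

Record sgraph := SGraph {
  vertex :> finType;
  edge : rel vertex;
  edge_sym : symmetric edge;
  edge_irr : irreflexive edge }.

Section GraphProduct.
Variables (Gm : sgraph) (G : Gm -> groupType).

Definition syllable := {v : Gm & G v}.
Definition syl v (x : G v) : syllable := Tagged (fun v => G v) x.

(* The first six constructors present the free product of the G v: words in
   the elements of the vertex groups, multiplied by concatenation, modulo
   multiplication inside each G v.  The last one adds the graph relations. *)
Inductive gp_eqv : seq syllable -> seq syllable -> Prop :=
| gp_refl w : gp_eqv w w
| gp_sym w1 w2 : gp_eqv w1 w2 -> gp_eqv w2 w1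
| gp_trans w1 w2 w3 : gp_eqv w1 w2 -> gp_eqv w2 w3 -> gp_eqv w1 w3
| gp_cat w1 w1' w2 w2' :
    gp_eqv w1 w1' -> gp_eqv w2 w2' -> gp_eqv (w1 ++ w2) (w1' ++ w2')
| gp_one v : gp_eqv [:: syl (1 : G v)] [::]
| gp_mul v (x y : G v) : gp_eqv [:: syl x; syl y] [:: syl (x * y)]
| gp_comm u v (x : G u) (y : G v) :
    edge u v -> gp_eqv [:: syl x; syl y] [:: syl y; syl x].

Definition gp_rel : rel (seq syllable) := fun w1 w2 => `[< gp_eqv w1 w2 >].

Lemma gp_rel_refl : reflexive gp_rel.
Proof. by move=> w; apply/asboolP/gp_refl. Qed.

Lemma gp_rel_sym : symmetric gp_rel.
Proof. by move=> w1 w2; apply/asboolP/asboolP; apply: gp_sym. Qed.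

Lemma gp_rel_trans : transitive gp_rel.
Proof.
by move=> w2 w1 w3 /asboolP h1 /asboolP h2; apply/asboolP/(gp_trans h1).
Qed.

Canonical gp_equiv := EquivRel gp_rel gp_rel_refl gp_rel_sym gp_rel_trans.

Definition graph_product := {eq_quot gp_equiv}%qT.
HB.instance Definition _ := Choice.on graph_product.
HB.instance Definition _ := EqQuotient.on graph_product.

Definition gp_class (w : seq syllable) : graph_product := \pi_graph_product%qT w.

Lemma gp_classP w1 w2 : gp_class w1 = gp_class w2 <-> gp_eqv w1 w2.
Proof.
split=> [/eqmodP/asboolP // | h].
by apply/eqmodP/asboolP.
Qed.

Lemma gp_class_repr (p : graph_product) : gp_class (repr p) = p.
Proof. exact: reprK. Qed.

Lemma gp_repr_class w : gp_eqv (repr (gp_class w)) w.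
Proof. by apply/gp_classP; rewrite gp_class_repr. Qed.

Definition inv_word (w : seq syllable) : seq syllable :=
  rev [seq syl (v := tag s) (tagged s)^-1 | s <- w].

Lemma inv_word_cat w1 w2 : inv_word (w1 ++ w2) = inv_word w2 ++ inv_word w1.
Proof. by rewrite /inv_word map_cat rev_cat. Qed.

Lemma inv_wordK : involutive inv_word.
Proof.
move=> w; rewrite /inv_word map_rev revK -map_comp map_id_in //.
by case=> v x _; rewrite /= invgK.
Qed.

Lemma gp_eqv_inv w1 w2 : gp_eqv w1 w2 -> gp_eqv (inv_word w1) (inv_word w2).
Proof.
elim=> {w1 w2} [w|w1 w2 _ h|w1 w2 w3 _ h1 _ h2|w1 w1' w2 w2' _ h1 _ h2|v|v x y|
                u v x y e].
- exact: gp_refl.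
- exact: gp_sym.
- exact: gp_trans h1 h2.
- by rewrite !inv_word_cat; apply: gp_cat.
- by rewrite /inv_word /= invg1; apply: gp_one.
- by rewrite /inv_word /= invMg; apply: gp_mul.
- by apply: gp_comm; rewrite edge_sym.
Qed.

Lemma gp_eqv_mulV w : gp_eqv (w ++ inv_word w) [::].
Proof.
elim: w => [|[v x] w IHw]; first exact: gp_refl.
rewrite -cat1s inv_word_cat -catA (catA w).
apply: gp_trans (gp_cat (gp_refl _) (gp_cat IHw (gp_refl _))) _.
by apply: gp_trans (gp_mul _ _) _; rewrite mulgV; apply: gp_one.
Qed.

Definition gp_unit : graph_product := gp_class [::].
Definition gp_op (p q : graph_product) := gp_class (repr p ++ repr q).
Definition gp_inv (p : graph_product) := gp_class (inv_word (repr p)).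

Lemma gp_opE w1 w2 : gp_op (gp_class w1) (gp_class w2) = gp_class (w1 ++ w2).
Proof. by apply/gp_classP/gp_cat; apply: gp_repr_class. Qed.

Lemma gp_invE w : gp_inv (gp_class w) = gp_class (inv_word w).
Proof. by apply/gp_classP/gp_eqv_inv/gp_repr_class. Qed.

Lemma gp_opA : associative gp_op.
Proof.
move=> p q r; rewrite -[p]gp_class_repr -[q]gp_class_repr -[r]gp_class_repr.
by rewrite !gp_opE catA.
Qed.

Lemma gp_op1g : left_id gp_unit gp_op.
Proof. by move=> p; rewrite -[p]gp_class_repr gp_opE. Qed.

Lemma gp_opg1 : right_id gp_unit gp_op.
Proof. by move=> p; rewrite -[p]gp_class_repr gp_opE cats0. Qed.

Lemma gp_opVg : left_inverse gp_unit gp_inv gp_op.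
Proof.
move=> p; rewrite -[p]gp_class_repr gp_invE gp_opE; apply/gp_classP.
by rewrite -[X in _ ++ X]inv_wordK; apply: gp_eqv_mulV.
Qed.

Lemma gp_opgV : right_inverse gp_unit gp_inv gp_op.
Proof.
move=> p; rewrite -[p]gp_class_repr gp_invE gp_opE; apply/gp_classP.
exact: gp_eqv_mulV.
Qed.

HB.instance Definition _ :=
  isGroup.Build graph_product gp_opA gp_op1g gp_opg1 gp_opVg gp_opgV.

End GraphProduct.

Definition isomorphic (A B : groupType) : Prop :=
  exists f : {multiplicative A -> B}, bijective f.

Definition racg (A : groupType) : Prop :=
  exists (Gm : sgraph) (G : Gm -> finGroupType),
    (forall v, #|G v| = 2%N) /\ isomorphic A (graph_product (fun v => G v)).

Inductive term :=
| Var of nat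
| One
| Mul of term & term
| Inv of term.

Inductive formula :=
| Equal of term & term
| And of formula & formula
| Or of formula & formula
| Implies of formula & formula
| Not of formula
| Exists of nat & formula
| Forall of nat & formula.

Fixpoint term_vars (t : term) : seq nat :=
  match t with
  | Var i => [:: i]
  | One => [::]
  | Mul t1 t2 => term_vars t1 ++ term_vars t2
  | Inv t1 => term_vars t1
  end.

Fixpoint free_vars (f : formula) : seq nat :=
  match f with
  | Equal t1 t2 => term_vars t1 ++ term_vars t2
  | And f1 f2 | Or f1 f2 | Implies f1 f2 => free_vars f1 ++ free_vars f2
  | Not f1 => free_vars f1
  | Exists i f1 | Forall i f1 => [seq j <- free_vars f1 | j != i]
  end.

Definition sentence (f : formula) : Prop := free_vars f = [::].

Section Semantics.
Variable A : groupType.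

Definition update (e : nat -> A) (i : nat) (a : A) : nat -> A :=
  fun j => if j == i then a else e j.

Fixpoint eval (e : nat -> A) (t : term) : A :=
  match t with
  | Var i => e i
  | One => 1
  | Mul t1 t2 => eval e t1 * eval e t2
  | Inv t1 => (eval e t1)^-1
  end.

Fixpoint holds (e : nat -> A) (f : formula) : Prop :=
  match f with
  | Equal t1 t2 => eval e t1 = eval e t2
  | And f1 f2 => holds e f1 /\ holds e f2
  | Or f1 f2 => holds e f1 \/ holds e f2
  | Implies f1 f2 => holds e f1 -> holds e f2
  | Not f1 => ~ holds e f1
  | Exists i f1 => exists a : A, holds (update e i a) f1
  | Forall i f1 => forall a : A, holds (update e i a) f1
  end.

(* On a sentence the valuation is irrelevant, so the constant one will do. *)
Definition satisfies (f : formula) : Prop := holds (fun=> 1) f.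

End Semantics.

Definition elem_equiv (A B : groupType) : Prop :=
  forall f : formula, sentence f -> (satisfies A f <-> satisfies B f).

(* Main.v *)
Require Import Defs.
From HB Require Import structures.
From mathcomp Require Import all_boot fingroup gproduct perm.
From mathcomp Require Import boolp.

(** An isomorphism preserves the truth of every sentence, so the content is
    that the theory of a graph product G of finite groups over a finite graph
    determines G up to isomorphism.

    Let P be the direct product of all the vertex groups.  There is a
    homomorphism [proj] from G onto P, and [embed] lifts the f in P whose support is a clique
    back to G, compatibly with products inside one clique.  These lifts are the
    elements of the clique subgroups, and the relations between them present G.
    So G is the universal group of a finite partial group: the f in P with
    clique support, where f * g is defined when [compat f g], that is, when one
    clique contains both supports.  A bijection between two such partial groups
    that preserves products in both directions extends to an isomorphism of the
    graph products ([ce_isomorphic]).  Partial groups are the right objects to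
    compare because the graph is not canonical: a vertex group that is a direct
    product may be split into adjacent vertices, and in several ways.

    It remains to read off the partial group from the theory.  The structural
    fact is that an element of finite order of G is conjugate to an element of
    a clique subgroup ([torsion_clique]); hence its image in P has clique
    support and determines it up to conjugacy ([torsion_are_conj]).  One
    sentence, the existential closure of [diagram], says that there are elements
    indexed by the letters of G that satisfy its relations, and that those of
    their products which come from f and g in P with clique support are
    conjugate only if f and g are.  It holds in G.  If it holds in another
    such product G', it gives a homomorphism phi from G to G', and
    al f = proj (phi (embed f)) is an injective map of partial groups
    ([hom_clique_embedding]).  It preserves [compat]: if u in the support of
    al f and v in that of al g were distinct and not adjacent, then neither would
    be in the other support, both being cliques, so u and v would both be in the
    support of al (f * g), which is a clique because phi (embed (f * g)) has finite
    order.  By symmetry there is also such a map be from G' to G.  The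
    composite be o al is an injection of a finite set into itself, so some power
    of it is the identity, and the inverse of al is be followed by a power of
    be o al; it is therefore a map of partial groups too ([ce_inverse]).

    The structural fact needs the normal form theorem: a nonempty reduced word
    is not trivial ([reduced_eqv_nil]).  It is proved by letting the graph
    product act on piles.  A word of minimal length in the conjugacy class of x
    is reduced, and so are all its cyclic rotations.  If two of its letters do
    not commute by adjacency, delete the letters whose vertex is adjacent to
    those of all the others; every power of the remaining nonempty word is
    reduced, so x has infinite order ([torsion_conj_clique]). *)

Set Implicit Arguments.
Unset Strict Implicit.
Unset Printing Implicit Defensive.

Local Open Scope group_scope.

Local Notation hom := UMagmaMorphism.type.
Local Notation prodG G := {dffun forall v, G v}.
Local Notation GP G := (graph_product (fun v => G v)).

(** * Reduced words *)

Section Words.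
Variables (Gm : sgraph) (G : Gm -> finGroupType).

Notation syllable := (syllable (fun v => G v)).
Notation syl := (@syl Gm (fun v => G v) _).
Notation gp_eqv := (@gp_eqv Gm (fun v => G v)).
Notation gp_class := (@gp_class Gm (fun v => G v)).

Implicit Types (w a b c : seq syllable) (s t : syllable).

(** Some letter of [w] at [v] can be brought to the front by commutations.  The
    scan cannot pass a letter at [v], because [v] is not adjacent to itself. *)
Fixpoint exposed (v : Gm) w : bool :=
  if w is s :: w' then (tag s == v) || edge v (tag s) && exposed v w'
  else false.

Fixpoint reduced w : bool :=
  if w is s :: w' then
    [&& tagged s != 1, ~~ exposed (tag s) w' & reduced w']
  else true.

Definition adjacent_to v w := all (fun s => edge v (tag s)) w.

Lemma exposed_cat v a b :
  exposed v (a ++ b) = exposed v a || adjacent_to v a && exposed v b.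
Proof. by elim: a => //= s a ->; case: (_ == v); case: (edge _ _). Qed.

Lemma exposedP v w : exposed v w ->
  exists a (x : G v) b, w = a ++ syl x :: b /\ adjacent_to v a.
Proof.
elim: w => //= -[u x] w IHw /orP[/eqP /= <-|/= /andP[uv /IHw[a [y [b [-> va]]]]]].
  by exists [::], x, w.
by exists (syl x :: a), y, b; rewrite /= uv.
Qed.

Lemma gp_eqv_comm v (x : G v) a :
  adjacent_to v a -> gp_eqv (syl x :: a) (a ++ [:: syl x]).
Proof.
elim: a => [|[u y] a IHa] /=; first by move=> _; apply: gp_refl.
case/andP=> uv /IHa h; rewrite -[_ :: _ :: a]/([:: syl x; syl y] ++ a).
apply: gp_trans (gp_cat (gp_comm _ _ uv) (gp_refl _)) _.
exact: (gp_cat (gp_refl [:: syl y])).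
Qed.

Lemma gp_eqv_cons s w1 w2 : gp_eqv w1 w2 -> gp_eqv (s :: w1) (s :: w2).
Proof. exact: (gp_cat (gp_refl [:: s])). Qed.

Lemma unreduced_shorter w : ~~ reduced w ->
  exists2 w', gp_eqv w w' & size w' < size w.
Proof.
elim: w => //= -[v x] w IHw /=; case: (eqVneq x 1) => [-> _|_] /=.
  by exists w; rewrite //; apply: (gp_cat (gp_one _ _) (gp_refl w)).
case: (boolP (exposed v w)) => /=; last first.
  move=> _ /IHw[w' ww' lt].
  by exists (syl x :: w') => //; apply: gp_eqv_cons.
case/exposedP=> a [y [b [-> va]]] _.
exists (a ++ syl (x * y) :: b); last by rewrite !size_cat /= addnS.
rewrite -cat_cons; apply: gp_trans (gp_cat (gp_eqv_comm x va) (gp_refl _)) _.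
rewrite -catA /=; apply: gp_cat (gp_refl _) _.
exact: gp_cat (gp_mul x y) (gp_refl b).
Qed.

(** Deleting all letters outside a set of vertices is the retraction of the graph
    product that kills the other vertex groups. *)
Lemma gp_eqv_filter (p : pred Gm) w1 w2 : gp_eqv w1 w2 ->
  gp_eqv [seq s <- w1 | p (tag s)] [seq s <- w2 | p (tag s)].
Proof.
elim=> {w1 w2} [w|w1 w2 _ h|w1 w2 w3 _ h1 _ h2|w1 w1' w2 w2' _ h1 _ h2|v|v x y|
                u v x y e] /=.
- exact: gp_refl.
- exact: gp_sym.
- exact: gp_trans h1 h2.
- by rewrite !filter_cat; apply: gp_cat.
- by case: (p v); [apply: gp_one | apply: gp_refl].
- by case: (p v); [apply: gp_mul | apply: gp_refl].
- by case: (p u); case: (p v); (exact: gp_refl || exact: gp_comm).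
Qed.

(** * Piles and the normal form theorem *)

(** A pile configuration records a reduced word up to commutations: each letter
    puts its value on the stack of its own vertex and the marker 1 on the stacks
    of the other nonadjacent vertices.  The front letters of the word are then
    the entries different from 1 on top of the stacks.  All stacks hold elements
    of the direct product so that they have one type. *)
Definition pile := Gm -> seq (prodG G).
Implicit Types p q : pile.

Definition put (v : Gm) (x : prodG G) p : pile :=
  if x == 1 then p
  else fun u => if u == v then x :: p u else if edge v u then p u else 1 :: p u.

(** The default 1 makes an empty stack look like one under a marker: in both cases
    no letter at [v] can be brought to the front. *)
Definition top p v : prodG G := head 1 (p v).

Definition strip v p : pile :=
  if top p v == 1 then p else fun u => if edge v u then p u else behead (p u).

Inductive valid : pile -> Prop :=
| valid_nil : valid (fun=> [::])
| valid_put v x p : top p v = 1 -> valid p -> valid (put v x p).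

Lemma put1 v p : put v 1 p = p.
Proof. by rewrite /put eqxx. Qed.

Lemma top_put v x p : top p v = 1 -> top (put v x p) v = x.
Proof.
by rewrite /put; case: (eqVneq x 1) => [->|_ _] //; rewrite /top eqxx.
Qed.

Lemma top_put_adj u v x p : edge u v -> top (put u x p) v = top p v.
Proof.
rewrite /put /top; case: (x == 1) => // uv.
by rewrite uv; case: eqP => // e; rewrite e edge_irr in uv.
Qed.

Lemma putK v x p : top p v = 1 -> strip v (put v x p) = p.
Proof.
move=> pv; rewrite /strip top_put // /put; case: (x == 1) => //.
apply/funext=> u; case: (eqVneq u v) => [->|_]; last by case: (edge v u).
by rewrite edge_irr.
Qed.

Lemma put_comm u v x y p : edge u v ->
  put u x (put v y p) = put v y (put u x p).
Proof.
move=> uv; rewrite /put; case: (x == 1) => //; case: (y == 1) => //.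
apply/funext=> z; have vu : edge v u by rewrite edge_sym.
case: (eqVneq z u) => [->|_].
  by rewrite vu; case: eqP => // e; rewrite e edge_irr in uv.
by case: (eqVneq z v) => [->|_]; [rewrite uv | case: (edge u z); case: (edge v z)].
Qed.

(** If a letter at [v] is on top, a letter put at [u] after it must be adjacent to
    [v], or else its marker would cover it; so the two can be exchanged.  Hence
    every valid configuration is a letter at [v], possibly trivial, put on one
    without a top letter at [v].  This is what turns left multiplication by the
    vertex group at [v] into an action. *)
Lemma valid_split v p : valid p ->
  exists2 q, valid q /\ top q v = 1 & p = put v (top p v) q.
Proof.
elim=> [|u x {}p pu vp [q [vq qv] def_p]].
  by exists (fun=> [::]); [split; first exact: valid_nil | rewrite /put eqxx].
have [->|xn1] := eqVneq x 1; first by exists q; rewrite // /put eqxx.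
have [->|vu] := eqVneq v u; first by exists p; rewrite ?top_put.
case uv: (edge u v); last first.
  have tv : top (put u x p) v = 1 by rewrite /put (negPf xn1) /top (negPf vu) uv.
  by exists (put u x p); rewrite ?tv ?put1 //; split=> //; apply: valid_put.
have vu' : edge v u by rewrite edge_sym.
have qu : top q u = 1 by rewrite -pu def_p top_put_adj.
exists (put u x q); first by split; [exact: valid_put | rewrite top_put_adj].
by rewrite top_put_adj // {1}def_p put_comm.
Qed.

Definition act v (x : prodG G) p : pile := put v (x * top p v) (strip v p).

Lemma act_put v x y p : top p v = 1 -> act v x (put v y p) = put v (x * y) p.
Proof. by move=> pv; rewrite /act top_put // putK. Qed.

Lemma act1 v p : valid p -> act v 1 p = p.
Proof. by case/(valid_split v)=> q [_ qv] ->; rewrite act_put ?mul1g. Qed.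

Lemma actM v x y p : valid p -> act v x (act v y p) = act v (x * y) p.
Proof. by case/(valid_split v)=> q [_ qv] ->; rewrite !act_put ?mulgA. Qed.

Lemma act_comm u v x y p : edge u v -> valid p ->
  act u x (act v y p) = act v y (act u x p).
Proof.
move=> uv /(valid_split v)[q [/(valid_split u)[r [_ ru] ->]]].
have vu : edge v u by rewrite edge_sym.
rewrite top_put_adj // => rv ->.
have tv z : top (put u z r) v = 1 by rewrite top_put_adj.
have tu z : top (put v z r) u = 1 by rewrite top_put_adj.
by rewrite act_put // -2!(put_comm _ _ _ uv) !act_put // !(put_comm _ _ _ uv) act_put.
Qed.

Lemma valid_act v x p : valid p -> valid (act v x p).
Proof.
by case/(valid_split v)=> q [vq qv] ->; rewrite act_put //; apply: valid_put.
Qed.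

Definition acts w p : pile :=
  foldr (fun s => act (tag s) (dfung1 (tagged s))) p w.

Lemma acts_cat a b p : acts (a ++ b) p = acts a (acts b p).
Proof. exact: foldr_cat. Qed.

Lemma valid_acts w p : valid p -> valid (acts w p).
Proof. by move=> vp; elim: w => //= s w; apply: valid_act. Qed.

Lemma dfung1_1 v : dfung1 (1 : G v) = 1.
Proof.
apply/ffunP=> u; rewrite oneg_ffun.
by have [<-|vu] := eqVneq v u; rewrite ?dfung1_id ?dfung1_dflt.
Qed.

(** So the pile that a word builds depends only on its class in the graph product. *)
Lemma acts_eqv w1 w2 : gp_eqv w1 w2 -> forall p, valid p -> acts w1 p = acts w2 p.
Proof.
elim=> {w1 w2} [w|w1 w2 _ h|w1 w2 w3 _ h1 _ h2|w1 w1' w2 w2' _ h1 _ h2|v|v x y|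
                u v x y e] p vp //=.
- by rewrite h.
- by rewrite h1 ?h2.
- by rewrite !acts_cat h2 // h1 //; apply: valid_acts.
- by rewrite dfung1_1 act1.
- by rewrite actM // dfung1_morphM.
- exact: act_comm.
Qed.

Lemma dfung1_eq1 v (x : G v) : (dfung1 x == 1) = (x == 1).
Proof.
apply/eqP/eqP=> [e|->]; last exact: dfung1_1.
by rewrite -(dfung1_id x) e oneg_ffun.
Qed.

(** A reduced word acts on the empty configuration by putting its letters one after
    the other, without merging, so the front of the word can be read off. *)
Lemma top_acts_reduced w v :
  reduced w -> (top (acts w (fun=> [::])) v != 1) = exposed v w.
Proof.
elim: w v => [|[u x] w IHw] v /=; first by rewrite /top eqxx.
case/and3P=> xn1 uw rw; set p := acts w _.
have pu : top p u = 1 by apply/eqP/negPn; rewrite IHw.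
rewrite /act pu mulg1 /strip pu eqxx.
have [<-|uv] := eqVneq u v; first by rewrite top_put ?dfung1_eq1.
case e: (edge v u) => /=; first by rewrite top_put_adj ?IHw // edge_sym.
by rewrite /top /put dfung1_eq1 (negPf xn1) [v == u]eq_sym (negPf uv) edge_sym e eqxx.
Qed.

(** The normal form theorem for graph products. *)
Lemma reduced_eqv_nil w : reduced w -> gp_eqv w [::] -> w = [::].
Proof.
case: w => // s w rw /acts_eqv/(_ _ valid_nil)/= e.
have: exposed (tag s) (s :: w) by rewrite /= eqxx.
by rewrite -(top_acts_reduced _ rw) /= e /top eqxx.
Qed.

End Words.

(** * Elements of finite order are conjugate into cliques *)

Section Torsion.
Variables (Gm : sgraph) (G : Gm -> finGroupType).

Notation syllable := (syllable (fun v => G v)).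
Notation syl := (@syl Gm (fun v => G v) _).
Notation gp_eqv := (@gp_eqv Gm (fun v => G v)).
Notation gp_class := (@gp_class Gm (fun v => G v)).

Implicit Types (w a b c : seq syllable) (s t : syllable) (x y z : GP G).

Lemma gp_class_cat a b : gp_class (a ++ b) = gp_class a * gp_class b.
Proof. exact/esym/gp_opE. Qed.

Lemma gp_class_surj x : exists w, x = gp_class w.
Proof. by exists (generic_quotient.repr x); rewrite gp_class_repr. Qed.

Lemma gp_class_nil : gp_class [::] = 1.
Proof. by []. Qed.

Lemma gp_class_nseq w n : gp_class (flatten (nseq n w)) = gp_class w ^+ n.
Proof. by elim: n => //= n IHn; rewrite gp_class_cat IHn expgS. Qed.

(** When [v] is the vertex of a letter of [w], that letter is counted, so the value
    is 1 exactly when [v] is adjacent to the vertices of all the other letters. *)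
Definition blocking w (v : Gm) := count (fun s => ~~ edge v (tag s)) w.

Lemma blocking_gt1 w v s t :
  s \in w -> t \in w -> s != t -> ~~ edge v (tag s) -> ~~ edge v (tag t) ->
  1 < blocking w v.
Proof.
move=> sw tw st vs vt; rewrite /blocking -size_filter.
apply: (@uniq_leq_size _ [:: s; t]); first by rewrite /= inE st.
by move=> r /[!inE]/orP[]/eqP->; rewrite mem_filter ?vs ?vt.
Qed.

Lemma blocking_le1_clique w :
  {in w, forall s, blocking w (tag s) <= 1} ->
  pairwise (fun s t => edge (tag s) (tag t)) w.
Proof.
elim: w => //= s w IHw le1; apply/andP; split; last first.
  apply: IHw => t tw; apply: leq_trans (le1 t _); last by rewrite inE tw orbT.
  exact: leq_addl.
have := le1 s (mem_head _ _); rewrite /blocking /= edge_irr /= add1n ltnS leqn0.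
rewrite eqn0Ngt -has_count -all_predC => /allP all_w.
by apply/allP=> t /all_w /= /negPn.
Qed.

(** A letter with [blocking] 1 merges with its copies in a power of [w].  If all
    rotations of [w] are reduced, the other letters, the core, do not, so [w] has
    infinite order unless the core is empty. *)
Section Core.
Variable w : seq syllable.

Definition blocked (v : Gm) := 1 < blocking w v.
Definition core a := [seq s <- a | blocked (tag s)].

Hypothesis rotate_min : forall a b, w = a ++ b -> reduced (b ++ a).

Lemma unblocked_adj s t : s \in w -> t \in w -> blocked (tag s) ->
  ~~ blocked (tag t) -> edge (tag s) (tag t).
Proof.
move=> sw tw bs bt; apply: contraR (bt) => st.
apply: (blocking_gt1 sw tw); rewrite ?edge_irr // 1?edge_sym //.
by apply: contraNneq bt => <-.
Qed.

Lemma adjacent_to_core s a : s \in w -> blocked (tag s) -> {subset a <= w} ->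
  adjacent_to (tag s) (core a) -> adjacent_to (tag s) a.
Proof.
move=> sw bs aw /allP adj; apply/allP=> t ta.
case bt: (blocked (tag t)); first by apply: adj; rewrite mem_filter bt.
by rewrite (unblocked_adj sw (aw _ ta)) ?bt.
Qed.

Lemma exposed_core s a : s \in w -> blocked (tag s) -> {subset a <= w} ->
  exposed (tag s) (core a) -> exposed (tag s) a.
Proof.
move=> sw bs; elim: a => //= t a IHa aw.
have tw : t \in w by apply: aw; rewrite mem_head.
have /IHa{}IHa : {subset a <= w} by move=> r ra; apply: aw; rewrite inE ra orbT.
case bt: (blocked (tag t)) => /=; last first.
  by rewrite (unblocked_adj sw tw) ?bt // => /IHa ->; rewrite orbT.
by case/orP=> [->|/andP[-> /IHa ->]]; rewrite ?orbT.
Qed.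

Lemma exposed_nseq s k : s \in w -> blocked (tag s) ->
  exposed (tag s) (flatten (nseq k (core w))) -> exposed (tag s) (core w).
Proof.
move=> sw bs; case: k => //= k; rewrite exposed_cat => /orP[//|/andP[adj _]].
have /allP/(_ s sw) := adjacent_to_core sw bs (fun _ => id) adj.
by rewrite edge_irr.
Qed.

(** A letter [s] of the core can only be cancelled by a letter of the next copy of
    the core, at the same vertex, if everything between them is adjacent to that
    vertex.  If the second letter lies before [s] in [w], then the rotation of
    [w] that starts at [s] is not reduced.  Otherwise all letters of [w] but [s]
    are adjacent to its vertex, so [s] is not in the core. *)
Lemma reduced_core_suffix k a b : w = a ++ b ->
  reduced (flatten (nseq k (core w))) ->
  reduced (core b ++ flatten (nseq k (core w))).
Proof.
move=> def_w rk; elim: b a def_w => //= s b IHb a def_w.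
have def_w' : w = rcons a s ++ b by rewrite cat_rcons.
have sw : s \in w by rewrite def_w mem_cat mem_head orbT.
have bw : {subset b <= w} by move=> t tb; rewrite def_w mem_cat inE tb !orbT.
have /= /and3P[sn1 exab _] := rotate_min def_w.
case bs: (blocked (tag s)); last exact: IHb def_w'.
rewrite /= sn1 (IHb _ def_w') andbT /=; move: exab; rewrite !exposed_cat.
apply: contra => /orP[/(exposed_core sw bs bw) -> //|/andP[]].
move=> /(adjacent_to_core sw bs bw) adj_b /(exposed_nseq sw bs).
move=> /(exposed_core sw bs (fun _ => id)).
rewrite adj_b {1}def_w exposed_cat => /orP[->|/andP[adj_a _]].
  by rewrite orbT.
move: bs; rewrite /blocked /blocking def_w count_cat /= edge_irr /=.
have no c : adjacent_to (tag s) c ->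
    count (fun t => ~~ edge (tag s) (tag t)) c = 0%N.
  move=> adj; apply/eqP; rewrite eqn0Ngt -has_count -all_predC.
  by apply: sub_all adj => t /= ->.
by rewrite !no.
Qed.

Lemma reduced_core_pow k : reduced (flatten (nseq k (core w))).
Proof.
by elim: k => // k; apply: (@reduced_core_suffix k [::] w).
Qed.

Lemma core_nil_of_pow k : 0 < k -> gp_eqv (flatten (nseq k w)) [::] ->
  core w = [::].
Proof.
move=> k_gt0 /(gp_eqv_filter blocked); rewrite /= => e.
have eqw : [seq s <- flatten (nseq k w) | blocked (tag s)]
           = flatten (nseq k (core w)).
  by rewrite filter_flatten map_nseq.
rewrite eqw in e; have := reduced_eqv_nil (reduced_core_pow k) e.
by case: (k) k_gt0 => //= k' _; case: (core w).
Qed.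

End Core.

Lemma torsion_conj_clique x n : 0 < n -> x ^+ n = 1 ->
  exists2 w, pairwise (fun s t => edge (tag s) (tag t)) w &
    exists z, x ^ z = gp_class w.
Proof.
move=> n_gt0 xn1.
(* A word of minimal length among those representing conjugates of x. *)
pose Q k := `[< exists2 w, size w = k & exists z, x ^ z = gp_class w >].
have exQ : exists k, Q k.
  have [w def_x] := gp_class_surj x; exists (size w); apply/asboolP.
  by exists w => //; exists 1; rewrite conjg1.
case: (ex_minnP exQ) => k /asboolP[w sz_w [z xz]] min.
(* Rotating w is a conjugation, so no rotation of w can be shortened. *)
have rot_w a b : w = a ++ b -> reduced (b ++ a).
  move=> def_w; apply: contraT => /unreduced_shorter[w' e].
  rewrite size_cat addnC -size_cat -def_w sz_w ltnNge => /negP[]; apply: min.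
  apply/asboolP; exists w' => //; exists (z * gp_class a).
  move/gp_classP: e => <-; rewrite conjgM xz def_w !gp_class_cat.
  by rewrite conjgE mulgA mulgA mulVg mul1g.
exists w; last by exists z.
apply: blocking_le1_clique => s sw.
have : gp_eqv (flatten (nseq n w)) [::].
  by apply/gp_classP; rewrite gp_class_nseq -xz -conjXg xn1 conj1g.
move=> /(core_nil_of_pow rot_w n_gt0) c0; rewrite leqNgt; apply/negP => bs.
have : s \in core w w by rewrite mem_filter /blocked bs.
by rewrite c0.
Qed.

End Torsion.

(** * Homomorphisms and conjugacy *)

(** Between groups, multiplicativity implies that 1 is preserved. *)
Lemma hom_of_morph (A B : groupType) (f : A -> B) :
  {morph f : x y / x * y} -> exists g : hom A B, f = g.
Proof.
move=> fM; have f1 : f 1 = 1.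
  by apply: (mulgI (f 1)); rewrite -fM !mulg1.
pose m := isUMagmaMorphism.Build A B f (f1, fM).
pose g : hom A B := HB.pack f m.
by exists g.
Qed.

Definition torsion (A : groupType) (x : A) := exists2 n, 0 < n & x ^+ n = 1.

Definition are_conj (A : groupType) (x y : A) := exists z, x ^ z = y.

Lemma are_conj_sym (A : groupType) (x y : A) : are_conj x y -> are_conj y x.
Proof. by case=> z <-; exists z^-1; rewrite conjgK. Qed.

Lemma are_conj_trans (A : groupType) (x y z : A) :
  are_conj x y -> are_conj y z -> are_conj x z.
Proof. by case=> p <- [q <-]; exists (p * q); rewrite conjgM. Qed.

Lemma prodgM_uniq (A : groupType) (I : eqType) (r : seq I) (F H : I -> A) :
  uniq r -> (forall i j, i != j -> commute (F i) (H j)) ->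
  \prod_(i <- r) (F i * H i) = \prod_(i <- r) F i * \prod_(i <- r) H i.
Proof.
move=> + FH; elim: r => [|i r IHr]; rewrite !(big_nil, big_cons) ?mulg1 //=.
case/andP=> ir /IHr->; rewrite !mulgA; congr (_ * _); rewrite -!mulgA.
congr (_ * _); rewrite big_seq_cond.
apply: commute_prod => j /andP[jr _]; apply/commute_sym/FH.
by apply: contraNneq ir => <-.
Qed.

(** * The projection to the direct product and its lifts over cliques *)

Section Cliques.
Variables (Gm : sgraph) (G : Gm -> finGroupType).

Notation syllable := (syllable (fun v => G v)).
Notation syl := (@syl Gm (fun v => G v) _).
Notation gp_eqv := (@gp_eqv Gm (fun v => G v)).
Notation gp_class := (@gp_class Gm (fun v => G v)).

Implicit Types (w a b c : seq syllable) (s t : syllable) (x y z : GP G).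
Implicit Types (f g h p : prodG G) (u v : Gm).

Definition letter v (a : G v) : GP G := gp_class [:: syl a].

Lemma gp_class_prod w : gp_class w = \prod_(s <- w) letter (tagged s).
Proof.
elim: w => [|[v x] w IHw]; rewrite ?big_nil ?big_cons //.
by rewrite -IHw -gp_class_cat.
Qed.

Lemma letterM v : {morph @letter v : a b / a * b}.
Proof. by move=> a b; rewrite /letter -gp_class_cat; apply/esym/gp_classP/gp_mul. Qed.

Lemma letter1 v : letter (1 : G v) = 1.
Proof. exact/gp_classP/gp_one. Qed.

Lemma letter_comm u v (a : G u) (b : G v) :
  edge u v -> commute (letter a) (letter b).
Proof.
by move=> uv; rewrite /commute -!gp_class_cat; apply/gp_classP/gp_comm.
Qed.

(** The universal property of graph products. *)
Lemma gp_lift (B : groupType) (phi : forall v, G v -> B) :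
    (forall v, {morph phi v : a b / a * b}) ->
    (forall u v (a : G u) (b : G v), edge u v -> commute (phi u a) (phi v b)) ->
  exists g : hom (GP G) B, forall v (a : G v), g (letter a) = phi v a.
Proof.
move=> phiM phiC; pose F s := phi (tag s) (tagged s).
have phi1 v : phi v 1 = 1 by apply: (mulgI (phi v 1)); rewrite -phiM !mulg1.
have FE w1 w2 : gp_eqv w1 w2 -> \prod_(s <- w1) F s = \prod_(s <- w2) F s.
  elim=> {w1 w2} [||w1 w2 w3 _ -> _ -> //|w1 w1' w2 w2' _ e1 _ e2|v|v a b|
                u v a b uv] //.
  - by rewrite !big_cat e1 e2.
  - by rewrite big_seq1 big_nil /F /= phi1.
  - by rewrite !big_cons !big_nil !mulg1 /F /= phiM.
  - by rewrite !big_cons !big_nil !mulg1; apply: phiC.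
pose f x := \prod_(s <- generic_quotient.repr x) F s.
have fE w : f (gp_class w) = \prod_(s <- w) F s by apply/FE/gp_repr_class.
have [|g fg] := @hom_of_morph (GP G) B f.
  move=> x y; have [a ->] := gp_class_surj x; have [b ->] := gp_class_surj y.
  by rewrite -gp_class_cat !fE big_cat.
by exists g => v a; rewrite -fg fE big_seq1.
Qed.

Lemma hom_eq_letter (B : groupType) (f g : hom (GP G) B) :
  (forall v (a : G v), f (letter a) = g (letter a)) -> f =1 g.
Proof.
move=> fg x; have [w ->] := gp_class_surj x; rewrite gp_class_prod.
by rewrite !gmulf_prod; apply: eq_bigr => s _; apply: fg.
Qed.

Lemma proj_exists :
  exists pi : hom (GP G) (prodG G), forall v (a : G v), pi (letter a) = dfung1 a.
Proof.
apply: gp_lift => [v|u v a b uv]; first exact: dfung1_morphM.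
apply/ffunP=> i; rewrite !mulg_ffun.
have [iu|] := eqVneq u i; last by move=> ui; rewrite dfung1_dflt ?mulg1 ?mul1g.
rewrite (@dfung1_dflt _ _ v) ?mulg1 ?mul1g // -iu.
by apply: contraTneq uv => ->; rewrite edge_irr.
Qed.

(** The projection onto the direct product of the vertex groups; it kills the
    commutators of nonadjacent vertex groups. *)
Definition proj : hom (GP G) (prodG G) := sval (cid proj_exists).

Lemma proj_letter v (a : G v) : proj (letter a) = dfung1 a.
Proof. exact: (svalP (cid proj_exists)). Qed.

Definition supp f : {set Gm} := [set v | f v != 1].

Definition clique (A : {set Gm}) : bool :=
  [forall u in A, forall v in A, (u == v) || edge u v].

Lemma cliqueP (A : {set Gm}) :
  reflect {in A &, forall u v, u != v -> edge u v} (clique A).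
Proof.
apply: (iffP forall_inP) => cA u => [v uA vA uv|uA].
  by have /forall_inP/(_ v vA) := cA u uA; rewrite (negPf uv).
by apply/forall_inP=> v vA; case: eqVneq => //= /(cA u v uA vA).
Qed.

Lemma clique_sub (A B : {set Gm}) : A \subset B -> clique B -> clique A.
Proof.
by move=> /subsetP AB /cliqueP cB; apply/cliqueP=> u v /AB uB /AB; apply: cB.
Qed.

(** Some clique contains both supports, so that [f * g] is computed inside one
    clique subgroup of the graph product. *)
Definition compat f g := clique (supp f :|: supp g).

Lemma suppM f g : supp (f * g) \subset supp f :|: supp g.
Proof.
apply/subsetP=> v; rewrite !inE mulg_ffun; apply: contraR.
by rewrite negb_or !negbK => /andP[/eqP-> /eqP->]; rewrite mulg1.
Qed.

Lemma supp1 : supp 1 = set0.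
Proof. by apply/setP=> v; rewrite !inE oneg_ffun eqxx. Qed.

Lemma suppV f : supp f^-1 = supp f.
Proof. by apply/setP=> v; rewrite !inE invg_ffun invg_eq1. Qed.

Lemma suppJ f p : supp (f ^ p) = supp f.
Proof.
by apply/setP=> v; rewrite !inE !mulg_ffun invg_ffun -conjgE conjg_eq1.
Qed.

Lemma supp_dfung1 v (a : G v) : supp (dfung1 a) \subset [set v].
Proof.
apply/subsetP=> u; rewrite !inE; apply: contraR => uv.
by rewrite dfung1_dflt // eq_sym.
Qed.

(** The factors are taken in the order of the enumeration of the vertices; the order
    matters unless the support of [f] is a clique, the only case of interest. *)
Definition embed f : GP G := \prod_v letter (f v).

Lemma dfung1_prod f : \prod_v dfung1 (f v) = f.
Proof.
apply/ffunP=> i; rewrite prodg_ffun (big_only1 i) ?dfung1_id //.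
by move=> j ij _; rewrite dfung1_dflt.
Qed.

Lemma embedK f : proj (embed f) = f.
Proof.
by rewrite /embed gmulf_prod -[RHS]dfung1_prod; apply: eq_bigr => v _;
   apply: proj_letter.
Qed.

Lemma embed_dfung1 v (a : G v) : embed (dfung1 a) = letter a.
Proof.
rewrite /embed (big_only1 v) ?dfung1_id // => u uv _.
by rewrite dfung1_dflt ?letter1 // eq_sym.
Qed.

Lemma embed1 : embed 1 = 1.
Proof. by rewrite /embed big1 // => v _; rewrite oneg_ffun letter1. Qed.

Lemma embedM f g : compat f g -> embed (f * g) = embed f * embed g.
Proof.
move=> /cliqueP fg; rewrite /embed -prodgM_uniq ?index_enum_uniq //.
  by apply: eq_bigr => v _; rewrite mulg_ffun letterM.
move=> u v uv.
have [->|fu] := eqVneq (f u) 1; first by rewrite letter1; apply/commute_sym/commute1.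
have [->|gv] := eqVneq (g v) 1; first by rewrite letter1; apply: commute1.
by apply/letter_comm/fg; rewrite ?inE ?fu ?gv ?orbT.
Qed.

Lemma compat_within (A : {set Gm}) f g :
  clique A -> supp f \subset A -> supp g \subset A -> compat f g.
Proof. by move=> cA fA gA; apply: clique_sub cA; rewrite subUset fA. Qed.

Lemma clique0 : clique set0.
Proof. by apply/cliqueP=> u v; rewrite inE. Qed.

Lemma clique1 v : clique [set v].
Proof. by apply/cliqueP=> u1 u2 /set1P-> /set1P->; rewrite eqxx. Qed.

Lemma compat_refl f : compat f f = clique (supp f).
Proof. by rewrite /compat setUid. Qed.

Lemma embedX f n : clique (supp f) -> embed (f ^+ n) = embed f ^+ n.
Proof.
move=> cf; have supX k : supp (f ^+ k) \subset supp f.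
  elim: k => [|k IHk]; first by rewrite expg0 supp1 sub0set.
  by rewrite expgS (subset_trans (suppM _ _)) // subUset subxx.
elim: n => [|n IHn]; first exact: embed1.
by rewrite !expgS embedM ?IHn //; apply: compat_within cf _ _.
Qed.

Lemma torsion_embed f : clique (supp f) -> torsion (embed f).
Proof.
by move=> cf; exists #[f]; rewrite -?embedX // expg_order embed1.
Qed.

(** A conjugating element of the direct product may be replaced by its restriction
    to the support of [f], which lifts to the same clique subgroup. *)
Lemma are_conj_embed f g :
  clique (supp f) -> are_conj f g -> are_conj (embed f) (embed g).
Proof.
move=> cf [p <-]; pose q : prodG G := [ffun v => if f v != 1 then p v else 1].
have fq : f ^ p = f ^ q.
  apply/ffunP=> v; rewrite !mulg_ffun !invg_ffun [q v]ffunE.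
  by have [->|//] := eqVneq (f v) 1; rewrite !mul1g !mulVg.
have qf : supp q \subset supp f.
  by apply/subsetP=> v; rewrite !inE ffunE; case: ifP => // _; rewrite eqxx.
exists (embed q); rewrite fq; apply: (mulgI (embed q)).
rewrite -conjgC -!embedM; first by rewrite -conjgC.
  by apply: compat_within cf _ _; rewrite ?suppJ.
exact: compat_within cf _ _.
Qed.

Definition tags w : {set Gm} := [set v | v \in map tag w].

Lemma supp_word w : supp (proj (gp_class w)) \subset tags w.
Proof.
elim: w => [|[v a] w IHw]; first by rewrite gp_class_nil gmulf1 supp1 sub0set.
rewrite (gp_class_cat [:: _]) gmulfM (subset_trans (suppM _ _)) // subUset.
rewrite [proj _]proj_letter (subset_trans (supp_dfung1 _)) /=; last first.
  by rewrite sub1set !inE eqxx.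
by apply: subset_trans IHw _; apply/subsetP=> u; rewrite !inE orbC => ->.
Qed.

Lemma clique_tags w :
  pairwise (fun s t => edge (tag s) (tag t)) w -> clique (tags w).
Proof.
elim: w => [|s w IHw] /=.
  by move=> _; apply/cliqueP=> u v; rewrite inE.
case/andP=> /allP sw /IHw/cliqueP cw; apply/cliqueP=> u v; rewrite !inE.
case/predU1P=> [->|uw] /predU1P[->|vw]; first by rewrite eqxx.
- by move=> _; case/mapP: vw => t /sw st ->.
- by move=> _; rewrite edge_sym; case/mapP: uw => t /sw st ->.
- by apply: cw; rewrite inE.
Qed.

Lemma embed_word w : pairwise (fun s t => edge (tag s) (tag t)) w ->
  embed (proj (gp_class w)) = gp_class w.
Proof.
elim: w => [|[v a] w IHw] pw; first by rewrite gmulf1 embed1.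
have /= /andP[_ /IHw {}IHw] := pw.
rewrite (gp_class_cat [:: _]) gmulfM embedM.
  by rewrite IHw [proj _]proj_letter embed_dfung1.
apply: compat_within (clique_tags pw) _ _.
  rewrite [proj _]proj_letter (subset_trans (supp_dfung1 _)) //.
  by rewrite sub1set !inE eqxx.
apply: subset_trans (supp_word w) _.
by apply/subsetP=> u; rewrite !inE orbC => ->.
Qed.

Lemma torsion_clique x : torsion x ->
  clique (supp (proj x)) /\ are_conj x (embed (proj x)).
Proof.
case=> n n_gt0 /(torsion_conj_clique n_gt0)[w pw [z xz]].
have px : proj x ^ proj z = proj (gp_class w) by rewrite -xz gmulfJ.
have cx : clique (supp (proj x)).
  rewrite -(suppJ _ (proj z)) px.
  exact: clique_sub (supp_word w) (clique_tags pw).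
split=> //; apply: (@are_conj_trans _ _ (gp_class w)); first by exists z.
apply: are_conj_sym; rewrite -(embed_word pw); apply: are_conj_embed => //.
by exists (proj z).
Qed.

(** Both elements are conjugate to the lift of their common image. *)
Lemma torsion_are_conj x y :
  torsion x -> torsion y -> proj x = proj y -> are_conj x y.
Proof.
move=> /torsion_clique[_ xp] /torsion_clique[_ yp] e.
by apply: are_conj_trans xp _; rewrite e; apply: are_conj_sym.
Qed.

End Cliques.
Arguments proj {Gm G}.

(** * Injections of partial groups *)

(** The values on elements whose support is not a clique are junk: only the partial
    group of elements with clique support, where [compat] pairs are multiplied,
    is constrained. *)
Record clique_embedding (Gm Gm' : sgraph)
    (G : Gm -> finGroupType) (H : Gm' -> finGroupType)
    (al : prodG G -> prodG H) : Prop := CliqueEmbedding {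
  ce_compat : forall f g, compat f g -> compat (al f) (al g);
  ce_mul : forall f g, compat f g -> al (f * g) = al f * al g;
  ce_inj : forall f g, clique (supp f) -> clique (supp g) ->
    al f = al g -> f = g }.

Lemma ce_clique (Gm Gm' : sgraph)
    (G : Gm -> finGroupType) (H : Gm' -> finGroupType)
    (al : prodG G -> prodG H) f :
  clique_embedding al -> clique (supp f) -> clique (supp (al f)).
Proof. by move=> ce; rewrite -!compat_refl; apply: ce_compat. Qed.

Lemma ce_comp (Gm1 Gm2 Gm3 : sgraph) (G1 : Gm1 -> finGroupType)
    (G2 : Gm2 -> finGroupType) (G3 : Gm3 -> finGroupType)
    (al : prodG G1 -> prodG G2) (be : prodG G2 -> prodG G3) :
  clique_embedding al -> clique_embedding be -> clique_embedding (be \o al).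
Proof.
move=> ca cb; split=> [f g fg|f g fg|f g cf cg /= e].
- exact/(ce_compat cb)/(ce_compat ca).
- by rewrite /= (ce_mul ca) // (ce_mul cb) //; apply: (ce_compat ca).
- by apply: (ce_inj ca) => //; apply: (ce_inj cb) e; apply: ce_clique.
Qed.

Lemma ce_id (Gm : sgraph) (G : Gm -> finGroupType) :
  clique_embedding (@id (prodG G)).
Proof. by []. Qed.

(** The inverse of a bijection that preserves [compat] need not preserve it.  Here
    it does, because the composite of the two injections permutes a finite set,
    so that the inverse of [al] is [be] followed by iterates of the composite. *)
Lemma ce_inverse (Gm Gm' : sgraph)
    (G : Gm -> finGroupType) (H : Gm' -> finGroupType)
    (al : prodG G -> prodG H) (be : prodG H -> prodG G) :
  clique_embedding al -> clique_embedding be ->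
  exists be' : prodG H -> prodG G, [/\ clique_embedding be',
    (forall f, clique (supp f) -> be' (al f) = f) &
    (forall f, clique (supp f) -> al (be' f) = f)].
Proof.
move=> ca cb; have cab := ce_comp ca cb.
(* The composite, made a permutation of the whole product by fixing the junk. *)
pose tau f := if clique (supp f) then be (al f) else f.
have tauP f : clique (supp f) -> tau f = be (al f) by rewrite /tau => ->.
have tau_cl f : clique (supp (tau f)) = clique (supp f).
  by rewrite /tau; case: ifP => // cf; rewrite (ce_clique cab).
have tauI : injective tau.
  move=> f g e.
  have e_cl : clique (supp f) = clique (supp g) by rewrite -tau_cl e tau_cl.
  have [cf|ncf] := boolP (clique (supp f)).
    have cg : clique (supp g) by rewrite -e_cl.
    by apply: (ce_inj cab) => //=; rewrite -!tauP.
  by move: e; rewrite /tau -e_cl (negPf ncf).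
pose s := perm tauI; pose n := #[s].-1.
have ce_iter k : clique_embedding (iter k (be \o al)).
  by elim: k => [|k IHk]; [apply: ce_id | apply: ce_comp IHk cab].
have iterE k f : clique (supp f) -> iter k (be \o al) f = (s ^+ k) f.
  move=> cf; rewrite permX; elim: k => //= k <-; rewrite permE tauP //.
  exact: ce_clique (ce_iter k) cf.
have ce' := ce_comp cb (ce_iter n); set be' := (X in clique_embedding X) in ce'.
have be'K f : clique (supp f) -> be' (al f) = f.
  move=> cf; have cba := ce_clique cab cf.
  rewrite /be' [LHS]/= iterE // -[be (al f)]tauP // -[tau f](permE tauI).
  by rewrite -permM -expgS prednK ?order_gt0 // expg_order perm1.
exists be'; split=> // f cf.
have cbf := ce_clique ce' cf.
apply: (ce_inj ce'); rewrite ?be'K //; exact: ce_clique ca cbf.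
Qed.

Section FromHom.
Variables (Gm Gm' : sgraph) (G : Gm -> finGroupType) (H : Gm' -> finGroupType).
Variable phi : hom (GP G) (GP H).
Hypothesis phi_conj : forall f g : prodG G,
  clique (supp f) -> clique (supp g) ->
  are_conj (phi (embed f)) (phi (embed g)) -> are_conj f g.

Let al (f : prodG G) : prodG H := proj (phi (embed f)).

Lemma torsion_hom (A B : groupType) (f : hom A B) x : torsion x -> torsion (f x).
Proof. by case=> n n_gt0 xn; exists n; rewrite // -gmulfXn xn gmulf1. Qed.

Lemma al_clique f : clique (supp f) -> clique (supp (al f)).
Proof. by move=> cf; case: (torsion_clique (torsion_hom phi (torsion_embed cf))). Qed.

Lemma al_mul f g : compat f g -> al (f * g) = al f * al g.
Proof. by move=> fg; rewrite /al embedM // !gmulfM. Qed.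

Lemma compatM f g : compat f g -> clique (supp (f * g : prodG G)).
Proof. by apply: clique_sub; apply: suppM. Qed.

(** A vertex in the support of exactly one of [al f] and [al g] is in the support of
    their product, which is a clique because the product is the image of an
    element of finite order. *)
Lemma al_compat f g : compat f g -> compat (al f) (al g).
Proof.
move=> fg; have cf : clique (supp f) by apply: clique_sub fg; apply: subsetUl.
have cg : clique (supp g) by apply: clique_sub fg; apply: subsetUr.
have /cliqueP caf := al_clique cf; have /cliqueP cag := al_clique cg.
have := al_clique (compatM fg); rewrite al_mul // => /cliqueP cafg.
have fg_edge u v : u != v -> u \in supp (al f) -> v \in supp (al g) -> edge u v.
  move=> uv uf vg.
  have [ug|ug] := boolP (u \in supp (al g)); first exact: cag.
  have [vf|vf] := boolP (v \in supp (al f)); first exact: caf.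
  apply: cafg => //; rewrite inE mulg_ffun.
    by move: ug uf; rewrite !inE negbK => /eqP->; rewrite mulg1.
  by move: vf vg; rewrite !inE negbK => /eqP->; rewrite mul1g.
apply/cliqueP=> u v /setUP[uf|ug] /setUP[vf|vg] uv.
- exact: caf.
- exact: fg_edge.
- by rewrite edge_sym fg_edge // eq_sym.
- exact: cag.
Qed.

(** If [al f = al g], then [phi (embed f)] and [phi (embed g)] are conjugate, having
    finite order and the same image.  By hypothesis [f] and [g] are conjugate,
    so they have the same support, and [f * g^-1] is defined in the partial
    group.  The same argument applied to it and 1 shows that it is trivial. *)
Lemma hom_clique_embedding : clique_embedding al.
Proof.
split; [exact: al_compat | exact: al_mul | move=> f g cf cg e].
have tor h : clique (supp h) -> torsion (phi (embed h)).
  by move=> ch; apply/torsion_hom/torsion_embed.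
have sfg : supp f = supp g.
  have [p <-] : are_conj f g; last by rewrite suppJ.
  by apply: phi_conj => //; apply: torsion_are_conj e; apply: tor.
pose h := f * g^-1.
have sh : supp h \subset supp g.
  by rewrite (subset_trans (suppM _ _)) // suppV sfg setUid.
have ch : clique (supp h) := clique_sub sh cg.
have al_h : al h = 1.
  have := @al_mul h g (compat_within cg sh (subxx _)).
  by rewrite /h mulgVK e -{1}[al g]mul1g => /mulIg.
have c1 : clique (supp (1 : prodG G)) by rewrite supp1 clique0.
have [p] : are_conj 1 h.
  apply: phi_conj => //; apply: torsion_are_conj; try exact: tor.
  by rewrite -/(al h) al_h embed1 !gmulf1.
by rewrite conj1g => /esym/divg1_eq.
Qed.

End FromHom.

(** The graph product is the universal group of its partial group: its defining
    relations are products of [compat] pairs. *)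
Lemma ce_lift (Gm Gm' : sgraph)
    (G : Gm -> finGroupType) (H : Gm' -> finGroupType)
    (al : prodG G -> prodG H) : clique_embedding al ->
  exists phi : hom (GP G) (GP H),
    forall f, clique (supp f) -> phi (embed f) = embed (al f).
Proof.
move=> ca.
have cM f g : compat f g -> embed (al (f * g)) = embed (al f) * embed (al g).
  by move=> fg; rewrite (ce_mul ca) // embedM //; apply: ce_compat.
have [|u v a b uv|phi phiE] :=
  @gp_lift _ G (GP H) (fun v (a : G v) => embed (al (dfung1 a))).
- move=> v a b; rewrite dfung1_morphM cM //.
  by apply: compat_within (clique1 v) _ _; apply: supp_dfung1.
- have cuv : clique [set u; v].
    apply/cliqueP=> u1 u2 /set2P[]-> /set2P[]->; rewrite ?eqxx // => _.
    by rewrite edge_sym.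
  have su : supp (dfung1 a) \subset [set u; v].
    by rewrite (subset_trans (supp_dfung1 _)) // subsetUl.
  have sv : supp (dfung1 b) \subset [set u; v].
    by rewrite (subset_trans (supp_dfung1 _)) // subsetUr.
  rewrite /commute -!cM; try exact: compat_within cuv _ _.
  congr (embed (al _)); rewrite -[LHS]embedK -[RHS]embedK.
  rewrite !embedM; try exact: compat_within cuv _ _.
  by rewrite !embed_dfung1 letter_comm.
exists phi => f cf; rewrite -{2}[f]dfung1_prod.
have sf v : supp (dfung1 (f v)) \subset supp f.
  apply/subsetP=> u; rewrite !inE; have [<-|vu] := eqVneq v u.
    by rewrite dfung1_id.
  by rewrite dfung1_dflt ?eqxx.
have al1 : embed (al 1) = 1.
  have c11 : compat (1 : prodG G) 1 by rewrite compat_refl supp1 clique0.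
  by apply: (mulgI (embed (al 1))); rewrite -cM // !mulg1.
rewrite /embed gmulf_prod -/(embed _); elim: (index_enum Gm) => [|v r IHr].
  by rewrite !big_nil al1.
rewrite !big_cons cM ?IHr ?phiE //; apply: compat_within cf _ _ => //.
elim: r {IHr} => [|u r IHr]; first by rewrite big_nil supp1 sub0set.
by rewrite big_cons (subset_trans (suppM _ _)) // subUset sf.
Qed.

Lemma ce_isomorphic (Gm Gm' : sgraph)
    (G : Gm -> finGroupType) (H : Gm' -> finGroupType)
    (al : prodG G -> prodG H) (be : prodG H -> prodG G) :
  clique_embedding al -> clique_embedding be -> isomorphic (GP G) (GP H).
Proof.
move=> ca cb; have [be' [cb' be'K al_be']] := ce_inverse ca cb.
have [phi phiE] := ce_lift ca; have [psi psiE] := ce_lift cb'.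
have c1 (Gm0 : sgraph) (G0 : Gm0 -> finGroupType) v (a : G0 v) :
    clique (supp (dfung1 a)).
  exact: clique_sub (supp_dfung1 a) (clique1 v).
exists phi; exists psi.
  apply: (@hom_eq_letter _ _ _ (psi \o phi) idfun) => v a /=.
  by rewrite -embed_dfung1 phiE ?psiE ?be'K // ?ce_clique.
apply: (@hom_eq_letter _ _ _ (phi \o psi) idfun) => v a /=.
by rewrite -embed_dfung1 psiE ?phiE ?al_be' // ?ce_clique.
Qed.

(** * Isomorphism and elementary equivalence *)

Lemma isomorphic_sym (A B : groupType) : isomorphic A B -> isomorphic B A.
Proof.
case=> f [g fK gK]; have [h gh] := hom_of_morph (can2_gmulfM fK gK).
by exists h; exists f; rewrite -gh.
Qed.

Lemma isomorphic_trans (A B C : groupType) :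
  isomorphic A B -> isomorphic B C -> isomorphic A C.
Proof.
move=> [f fb] [g gb]; have [|h gfh] := @hom_of_morph A C (g \o f).
  by move=> x y; rewrite /= !gmulfM.
by exists h; rewrite -gfh; apply: bij_comp.
Qed.

Lemma elem_equiv_sym (A B : groupType) : elem_equiv A B -> elem_equiv B A.
Proof. by move=> AB f sf; rewrite AB. Qed.

Lemma elem_equiv_trans (A B C : groupType) :
  elem_equiv A B -> elem_equiv B C -> elem_equiv A C.
Proof. by move=> AB BC f sf; rewrite AB // BC. Qed.

Lemma isomorphic_elem_equiv (A B : groupType) :
  isomorphic A B -> elem_equiv A B.
Proof.
case=> f0 [g fK gK]; have [f f0f] := hom_of_morph (@gmulfM _ _ f0).
rewrite f0f in fK gK.
have evalE e t : eval (f \o e) t = f (eval e t).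
  by elim: t => //= [|t1 -> t2 ->|t ->]; rewrite ?gmulf1 ?gmulfM ?gmulfV.
have updE e i a : f \o update e i a = update (f \o e) i (f a).
  by apply/funext=> j; rewrite /= /update; case: ifP.
have holdsE e F : holds (f \o e) F = holds e F.
  elim: F e => //= [t1 t2|F1 IH1 F2 IH2|F1 IH1 F2 IH2|F1 IH1 F2 IH2|F IH
                   |i F IH|i F IH] e; rewrite ?IH1 ?IH2 ?IH //.
  - by rewrite !evalE; apply/propext; split=> [/(can_inj fK)|->].
  - apply/propext; split=> -[a ha].
      by exists (g a); rewrite -IH updE gK.
    by exists (f a); rewrite -updE IH.
  - apply/propext; split=> ha a.
      by rewrite -IH updE; apply: ha.
    by rewrite -[a]gK -updE IH.
move=> F _; rewrite /satisfies -(holdsE (fun=> 1)).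
by rewrite (_ : f \o (fun=> 1) = fun=> 1) //; apply/funext=> i /=; rewrite gmulf1.
Qed.

(** * Existential closures and finite conjunctions *)

Definition ex_closure f := foldr Exists f (free_vars f).

Lemma free_vars_exists vs f :
  free_vars (foldr Exists f vs) = [seq j <- free_vars f | j \notin vs].
Proof.
elim: vs => /= [|i vs ->]; first by rewrite filter_predT.
by rewrite -filter_predI; apply: eq_filter => j /=; rewrite inE negb_or.
Qed.

Lemma sentence_closure f : sentence (ex_closure f).
Proof.
rewrite /sentence free_vars_exists; apply/eqP; rewrite -[_ == _]negbK -has_filter.
by apply/hasPn=> i ->.
Qed.

Lemma eq_eval (A : groupType) (e e' : nat -> A) t :
  {in term_vars t, e =1 e'} -> eval e t = eval e' t.
Proof.
elim: t => //= [i|t1 IH1 t2 IH2|t IH] ee'; first by apply: ee'; rewrite mem_head.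
  by rewrite IH1 ?IH2 // => i it; apply: ee'; rewrite mem_cat it ?orbT.
by rewrite IH.
Qed.

Lemma eq_holds (A : groupType) (e e' : nat -> A) f :
  {in free_vars f, e =1 e'} -> holds e f = holds e' f.
Proof.
have updE i a (e1 e2 : nat -> A) F : {in [seq j <- free_vars F | j != i], e1 =1 e2} ->
    {in free_vars F, update e1 i a =1 update e2 i a}.
  move=> e12 j jF; rewrite /update; case: eqP => // /eqP ji.
  by apply: e12; rewrite mem_filter ji.
have catE (s1 s2 : seq nat) (e1 e2 : nat -> A) : {in s1 ++ s2, e1 =1 e2} ->
    {in s1, e1 =1 e2} /\ {in s2, e1 =1 e2}.
  by move=> e12; split=> i is_; apply: e12; rewrite mem_cat is_ ?orbT.
elim: f e e' => //= [t1 t2|f1 IH1 f2 IH2|f1 IH1 f2 IH2|f1 IH1 f2 IH2|f IH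
                    |i f IH|i f IH] e e' ee'.
- by have [/eq_eval -> /eq_eval ->] := catE _ _ _ _ ee'.
- by have [/IH1 -> /IH2 ->] := catE _ _ _ _ ee'.
- by have [/IH1 -> /IH2 ->] := catE _ _ _ _ ee'.
- by have [/IH1 -> /IH2 ->] := catE _ _ _ _ ee'.
- by rewrite (IH e e').
- apply/propext; split=> -[a ha]; exists a; move: ha;
    by rewrite (IH _ _ (updE _ _ _ _ _ ee')).
- apply/propext; split=> ha a; move: (ha a);
    by rewrite (IH _ _ (updE _ _ _ _ _ ee')).
Qed.

Lemma satisfies_closure (A : groupType) f :
  satisfies A (ex_closure f) <-> exists e : nat -> A, holds e f.
Proof.
rewrite /satisfies /ex_closure; split=> [|[e he]].
  by move: (fun=> 1); elim: (free_vars f) => /= [|i vs IHvs] e; [exists e | case=> a /IHvs].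
have exI vs (e0 e1 : nat -> A) : (forall i, i \notin vs -> e0 i = e1 i) ->
    holds e1 f -> holds e0 (foldr Exists f vs).
  elim: vs e0 => /= [|i vs IHvs] e0 e01 h1.
    by rewrite (_ : e0 = e1) //; apply/funext=> i; apply: e01.
  exists (e1 i); apply: IHvs => // j jvs; rewrite /update; case: eqP => [->//|/eqP ji].
  by apply: e01; rewrite inE negb_or ji.
apply: (exI _ _ (fun i => if i \in free_vars f then e i else 1)).
  by move=> i /negPf->.
by rewrite -(@eq_holds _ e) // => i ->.
Qed.

Definition all_of (I : finType) (F : I -> formula) : formula :=
  foldr (fun i f => And (F i) f) (Equal One One) (enum I).

Lemma holds_all_of (A : groupType) (e : nat -> A) (I : finType) (F : I -> formula) :
  holds e (all_of F) <-> forall i, holds e (F i).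
Proof.
have: holds e (all_of F) <-> forall i, i \in enum I -> holds e (F i).
  rewrite /all_of; elim: (enum I) => //= i r IHr; rewrite IHr; split.
    by case=> hi hr j /predU1P[->|/hr].
  move=> h; split=> [|j jr]; first by apply: h; rewrite mem_head.
  by apply: h; rewrite inE jr orbT.
by move=> ->; split=> h i; [apply: h; rewrite mem_enum | move=> _].
Qed.

(** [b] is decided outside the formula; this writes a finite conjunction over a
    subset of the index type. *)
Definition guarded (b : bool) (f : formula) := if b then f else Equal One One.

Lemma holds_guarded (A : groupType) (e : nat -> A) b f :
  holds e (guarded b f) <-> (b -> holds e f).
Proof. by case: b; split=> //; apply. Qed.

(** * The sentence that describes the partial group *)

Section Diagram.
Variables (Gm : sgraph) (G : Gm -> finGroupType).

(** Variable 0 is kept for the conjugating element in [diagram]. *)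
Definition letter_var v (a : G v) := (pickle (Tagged G a)).+1.

Definition clique_term (f : prodG G) : term :=
  foldr (fun v t => Mul (Var (letter_var (f v))) t) One (index_enum Gm).

(** The multiplication tables and the commutation relations give a homomorphism from
    the graph product; the last part keeps nonconjugate elements of the clique
    subgroups nonconjugate. *)
Definition diagram : formula :=
  And (all_of (fun v => all_of (fun a : G v => all_of (fun b : G v =>
         Equal (Mul (Var (letter_var a)) (Var (letter_var b)))
               (Var (letter_var (a * b)))))))
  (And (all_of (fun u => all_of (fun v => guarded (edge u v)
         (all_of (fun a : G u => all_of (fun b : G v =>
           Equal (Mul (Var (letter_var a)) (Var (letter_var b)))
                 (Mul (Var (letter_var b)) (Var (letter_var a)))))))))
       (all_of (fun f : prodG G => all_of (fun g : prodG G =>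
         guarded [&& clique (supp f), clique (supp g) & ~~ `[< are_conj f g >]]
           (Not (Exists 0 (Equal
             (Mul (Inv (Var 0)) (Mul (clique_term f) (Var 0)))
             (clique_term g)))))))).

Lemma eval_clique_term (B : groupType) (e : nat -> B) f :
  eval e (clique_term f) = \prod_v e (letter_var (f v)).
Proof.
rewrite /clique_term; elim: (index_enum Gm) => [|v r IHr]; first by rewrite big_nil.
by rewrite big_cons -IHr.
Qed.

Lemma holds_diagram (B : groupType) (e : nat -> B) :
  holds e diagram <->
  [/\ forall v (a b : G v),
        e (letter_var (a * b)) = e (letter_var a) * e (letter_var b),
      forall u v (a : G u) (b : G v), edge u v ->
        commute (e (letter_var a)) (e (letter_var b)) &
      forall f g : prodG G, clique (supp f) -> clique (supp g) ->
        are_conj (\prod_v e (letter_var (f v))) (\prod_v e (letter_var (g v))) ->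
        are_conj f g].
Proof.
rewrite /diagram; split.
  case=> hM [hC hJ]; split=> [v a b|u v a b uv|f g cf cg [z zfg]].
  - by move/holds_all_of/(_ v)/holds_all_of/(_ a)/holds_all_of/(_ b): hM => /= ->.
  - move/holds_all_of/(_ u)/holds_all_of/(_ v)/holds_guarded/(_ uv): hC.
    by move/holds_all_of/(_ a)/holds_all_of/(_ b).
  - apply: contrapT => nfg.
    move/holds_all_of/(_ f)/holds_all_of/(_ g)/holds_guarded: hJ.
    rewrite cf cg /=; case; first exact/asboolPn.
    by exists z; rewrite !eval_clique_term /update eqxx.
case=> hM hC hJ; split; [|split].
- by do 3![apply/holds_all_of=> ?]; rewrite /= hM.
- apply/holds_all_of=> u; apply/holds_all_of=> v; apply/holds_guarded=> uv.
  by do 2![apply/holds_all_of=> ?]; apply: hC.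
- apply/holds_all_of=> f; apply/holds_all_of=> g; apply/holds_guarded.
  case/and3P=> cf cg /asboolPn nfg [z]; rewrite /= !eval_clique_term /update eqxx /=.
  by move=> zfg; apply: nfg; apply: hJ => //; exists z.
Qed.

(** The letters themselves are witnesses: the projection takes conjugate lifts to
    conjugate elements of the direct product. *)
Lemma graph_product_diagram : satisfies (GP G) (ex_closure diagram).
Proof.
apply/satisfies_closure.
pose val j : GP G :=
  if unpickle j : option {v & G v} is Some s then letter (tagged s) else 1.
have eE v (a : G v) : val (pickle (Tagged G a)) = letter a.
  by rewrite /val pickleK.
exists (fun i => if i is j.+1 then val j else 1).
apply/holds_diagram; split=> [v a b|u v a b uv|f g cf cg [z]] /=.
- by rewrite !eE letterM.
- by rewrite !eE; apply: letter_comm.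
under eq_bigr do rewrite eE; under [X in _ = X -> _]eq_bigr do rewrite eE.
move=> /(congr1 proj); rewrite gmulfJ -!/(embed _) !embedK => e.
by exists (proj z).
Qed.

End Diagram.

Lemma elem_equiv_clique_embedding (Gm Gm' : sgraph)
    (G : Gm -> finGroupType) (H : Gm' -> finGroupType) :
  elem_equiv (GP G) (GP H) ->
  exists al : prodG G -> prodG H, clique_embedding al.
Proof.
move/(_ _ (sentence_closure (diagram G)))=> [/(_ (@graph_product_diagram _ G)) + _].
case/satisfies_closure=> e /holds_diagram[eM eC eJ].
have [phi phiE] := gp_lift eM eC.
exists (fun f => proj (phi (embed f))); apply: hom_clique_embedding.
move=> f g cf cg; rewrite /embed !gmulf_prod.
under eq_bigr do rewrite phiE; under [X in are_conj _ X]eq_bigr do rewrite phiE.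
exact: eJ.
Qed.

Theorem corollary1p3 :
  (forall (Gm Gm' : sgraph)
          (G : Gm -> finGroupType) (H : Gm' -> finGroupType),
     elem_equiv (graph_product (fun v => G v)) (graph_product (fun w => H w))
     <-> isomorphic (graph_product (fun v => G v)) (graph_product (fun w => H w)))
  /\
  (forall (A B : groupType),
     racg A -> racg B -> (elem_equiv A B <-> isomorphic A B)).
Proof.
have main (Gm Gm' : sgraph) (G : Gm -> finGroupType) (H : Gm' -> finGroupType) :
    elem_equiv (GP G) (GP H) -> isomorphic (GP G) (GP H).
  move=> e; have [al ca] := elem_equiv_clique_embedding e.
  have [be cb] := elem_equiv_clique_embedding (elem_equiv_sym e).
  exact: ce_isomorphic ca cb.
split=> [Gm Gm' G H|A B [Gm [G [_ iA]]] [Gm' [H [_ iB]]]].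
  by split; [apply: main | apply: isomorphic_elem_equiv].
split=> [e|]; last exact: isomorphic_elem_equiv.
apply: (isomorphic_trans iA (isomorphic_trans _ (isomorphic_sym iB))).
apply: main.
have iA' := isomorphic_elem_equiv (isomorphic_sym iA).
exact: elem_equiv_trans iA' (elem_equiv_trans e (isomorphic_elem_equiv iB)).
Qed.
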